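(* Let $\underline{\mathbf{X}}\in\mathbb{R}^{I_1\times I_2\times I_3}$, let $\underline{\Omega}\in\mathbb{R}^{I_2\times k\times I_3}$ be a random tensor, let $\underline{\mathbf{Y}}=\underline{\mathbf{X}}*\underline{\Omega}$, $\underline{\mathbf{W}}=\underline{\mathbf{X}}^T*\underline{\mathbf{Y}}$, and let the economic T-SVD of $\underline{\mathbf{Y}}$ be $\underline{\mathbf{Y}}=\widehat{\underline{\mathbf{U}}}*\widehat{\underline{\mathbf{S}}}*\widehat{\underline{\mathbf{V}}}^T$, with $\widehat{\underline{\mathbf{S}}}\in\mathbb{R}^{k\times k\times I_3}$ invertible (equivalently $\underline{\mathbf{Y}}^T*\underline{\mathbf{Y}}$ invertible). Set $$\underline{\mathbf{Q}}=\underline{\mathbf{Y}}*\widehat{\underline{\mathbf{V}}}*\widehat{\underline{\mathbf{S}}}^{-1},\qquad \underline{\mathbf{B}}=(\underline{\mathbf{W}}*\widehat{\underline{\mathbf{V}}}*\widehat{\underline{\mathbf{S}}}^{-1})^T.$$ Then $\underline{\mathbf{Q}}*\underline{\mathbf{B}}$ is an approximation to $\underline{\mathbf{X}}$ with the same accuracy as the basic randomized T-SVD algorithm without power iteration or oversampling (described in the context, with the same $\underline{\Omega}$), that is, the error $\|\underline{\mathbf{X}}-\underline{\mathbf{Q}}*\underline{\mathbf{B}}\|_F$ equals the approximation error of that algorithm; and $$\|\underline{\mathbf{B}}\|_F^2=\operatorname{trace}\big(\underline{\mathbf{G}}^{(1)}\big),$$ where $\underline{\mathbf{G}}^{(1)}=\underline{\mathbf{G}}(:,:,1)$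 is the first frontal slice of $\underline{\mathbf{G}}=\underline{\mathbf{W}}^T*\underline{\mathbf{W}}*(\underline{\mathbf{Y}}^T*\underline{\mathbf{Y}})^{-1}$.
   Context: T-product: for $\underline{\mathbf{X}} \in \mathbb{R}^{I_1 \times I_2 \times I_3}$, $\underline{\mathbf{Y}} \in \mathbb{R}^{I_2 \times I_4 \times I_3}$, $(\underline{\mathbf{X}} * \underline{\mathbf{Y}})(i,j,:) = \sum_{k} \underline{\mathbf{X}}(i,k,:) * \underline{\mathbf{Y}}(k,j,:)$, with $*$ of tubes in $\mathbb{R}^{I_3}$ the circular convolution $(\mathbf{a}*\mathbf{b})(k)=\sum_{\ell=1}^{I_3}\mathbf{a}(\ell)\mathbf{b}(k-\ell+1)$, indices modulo $I_3$ in $\{1,\dots,I_3\}$; equivalently, matrix multiplication of frontal slices after the discrete Fourier transform (DFT) along the third mode. $\|\cdot\|_F$ is the Frobenius norm. The transpose $\underline{\mathbf{X}}^T$ transposes each frontal slice and reverses the order of the transposed slices $2,\dots,I_3$. The identity tensor has first frontal slice the identity matrix and all other frontal slices zero; inverses are with respect to the T-product and this identity. Random tensor: the first frontal slice is a standard Gaussian matrix and the other frontal slices are zero. An f-diagonal tensor has all frontal slices diagonal. The economic T-SVD $\underline{\mathbf{Y}}=\widehat{\underline{\mathbf{U}}}*\widehat{\underline{\mathbf{S}}}*\widehat{\underline{\mathbf{V}}}^T$ is obtained from the economic SVD of each frontal slice in the Fourier domain (conjugate-symmetrically, so that factors are real): for $\underline{\mathbf{Y}}\in\mathbb{R}^{I_1\times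 k\times I_3}$ with $k\le I_1$, $\widehat{\underline{\mathbf{U}}}\in\mathbb{R}^{I_1\times k\times I_3}$ with $\widehat{\underline{\mathbf{U}}}^T*\widehat{\underline{\mathbf{U}}}$ the identity, $\widehat{\underline{\mathbf{S}}}\in\mathbb{R}^{k\times k\times I_3}$ f-diagonal, $\widehat{\underline{\mathbf{V}}}\in\mathbb{R}^{k\times k\times I_3}$ orthogonal. Basic randomized T-SVD algorithm without power iteration or oversampling: let $\underline{\mathbf{Q}}_0=\operatorname{orth}(\underline{\mathbf{X}}*\underline{\Omega})\in\mathbb{R}^{I_1\times k\times I_3}$, where $\operatorname{orth}$ denotes the orthonormal factor of the thin T-QR decomposition (thin QR of each Fourier frontal slice, transformed back); form $\underline{\mathbf{B}}_0=\underline{\mathbf{Q}}_0^T*\underline{\mathbf{X}}$ (and take its economic T-SVD truncated to $k$ components, which is all of it); the resulting approximation to $\underline{\mathbf{X}}$ is $\underline{\mathbf{Q}}_0*\underline{\mathbf{B}}_0$. *)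

(* Defs.v *)
From mathcomp Require Import all_boot all_order all_algebra.
From mathcomp Require Import complex.
From mathcomp Require Import all_classical all_reals all_analysis.

Set Implicit Arguments.
Unset Strict Implicit.
Unset Printing Implicit Defensive.

Import Order.TTheory GRing.Theory Num.Theory.
Local Open Scope classical_set_scope.
Local Open Scope ring_scope.

(* A tensor is the family of its frontal slices: X l i j = X(i, j, l), with
   indices starting at 0. *)
Notation tensor K I1 I2 I3 := {ffun 'I_I3 -> 'M[K]_(I1, I2)}.

Section TProduct.
Context {R : realType} {N : nat}.

(* The third dimension is N.+1, so that +, - and 0 on 'I_N.+1 are those of the
   integers modulo N.+1. *)

Definition tube m p (X : tensor R m p N.+1) (i : 'I_m) (j : 'I_p) :
    {ffun 'I_N.+1 -> R} :=
  [ffun l => X l i j].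

Definition cconv (a b : {ffun 'I_N.+1 -> R}) : {ffun 'I_N.+1 -> R} :=
  [ffun q => \sum_l a l * b (q - l)].

Definition tmul m p q (X : tensor R m p N.+1) (Y : tensor R p q N.+1) :
    tensor R m q N.+1 :=
  [ffun l => \matrix_(i, j) (\sum_h cconv (tube X i h) (tube Y h j)) l].

(* l |-> - l fixes 0 and reverses the order of the slices 1, ..., N. *)
Definition ttr m p (X : tensor R m p N.+1) : tensor R p m N.+1 :=
  [ffun l => (X (- l))^T].

Definition tid m : tensor R m m N.+1 :=
  [ffun l => if l == 0 then 1%:M else 0].

Definition is_tinv m (A B : tensor R m m N.+1) : Prop :=
  tmul A B = tid m /\ tmul B A = tid m.

Definition tinvertible m (A : tensor R m m N.+1) : Prop :=
  exists B, is_tinv A B.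

(* The inverse of A, and the junk value 0 if A is not invertible. *)
Definition tinv m (A : tensor R m m N.+1) : tensor R m m N.+1 :=
  xget 0 [set B | is_tinv A B].

Definition fnorm m p (X : tensor R m p N.+1) : R :=
  Num.sqrt (\sum_l \sum_i \sum_j X l i j ^+ 2).

End TProduct.

Notation "X *t Y" := (tmul X Y) (at level 40, left associativity).

Section Fourier.
Context {R : realType} {N : nat}.

(* exp (- 2 pi i / N.+1) *)
Definition dft_root : R[i] :=
  let t := 2 * pi / N.+1%:R in Complex (cos t) (- sin t).

Definition dft m p (X : tensor R m p N.+1) (q : 'I_N.+1) : 'M[R[i]]_(m, p) :=
  \sum_(l < N.+1) dft_root ^+ (l * q) *: map_mx (real_complex R) (X l).

End Fourier.

Section Factorizations.
Context {R : realType}.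

Definition adjmx m p (A : 'M[R[i]]_(m, p)) : 'M[R[i]]_(p, m) :=
  (map_mx (@conjc R) A)^T.

(* 0 <= d 0 j in R[i] also says that d 0 j is real. *)
Definition is_econ_svd m k (A U : 'M[R[i]]_(m, k)) (S V : 'M[R[i]]_k) : Prop :=
  [/\ A = U *m S *m adjmx V,
      adjmx U *m U = 1%:M,
      adjmx V *m V = 1%:M &
      exists d : 'rV[R[i]]_k,
        [/\ S = diag_mx d, forall j, 0 <= d 0 j &
            forall i j : 'I_k, (i <= j)%N -> d 0 j <= d 0 i]].

Definition is_thin_qr m k (A Q : 'M[R[i]]_(m, k)) (T : 'M[R[i]]_k) : Prop :=
  [/\ A = Q *m T, adjmx Q *m Q = 1%:M &
      forall i j : 'I_k, (j < i)%N -> T i j = 0].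

Context {N : nat}.

(* The factors are real tensors, i.e. the factorizations of the Fourier slices
   are chosen conjugate-symmetrically. *)
Definition is_econ_tsvd m k (Y U : tensor R m k N.+1)
    (S V : tensor R k k N.+1) : Prop :=
  forall q, is_econ_svd (dft Y q) (dft U q) (dft S q) (dft V q).

Definition is_thin_tqr m k (Y Q : tensor R m k N.+1)
    (T : tensor R k k N.+1) : Prop :=
  forall q, is_thin_qr (dft Y q) (dft Q q) (dft T q).

(* A is an output of the basic randomized T-SVD algorithm with test tensor Om;
   a thin T-QR decomposition is not unique, hence a relation. *)
Definition is_basic_rtsvd m p k (X : tensor R m p N.+1)
    (Om : tensor R p k N.+1) (A : tensor R m p N.+1) : Prop :=
  exists Q0 : tensor R m k N.+1, exists T0 : tensor R k k N.+1,
    is_thin_tqr (X *t Om) Q0 T0 /\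
    let B0 := ttr Q0 *t X in A = Q0 *t B0.

End Factorizations.

Section RandomTensor.
Context {d : measure_display} {T : measurableType d} {R : realType}.
Variable P : probability T R.

Definition mutually_independent (J : finType) (Z : J -> T -> R) : Prop :=
  forall (K : {set J}) (A : J -> set R), (forall j, measurable (A j)) ->
    P (\bigcap_(j in [set` K]) (Z j @^-1` A j)) =
    (\prod_(j in K) P (Z j @^-1` A j))%E.

Definition standard_normal (Z : T -> R) : Prop :=
  measurable_fun setT Z /\
  forall A : set R, measurable A -> P (Z @^-1` A) = normal_prob 0 1 A.

Definition standard_gaussian_mx m p (M : T -> 'M[R]_(m, p)) : Prop :=
  (forall i j, standard_normal (fun w => M w i j)) /\
  mutually_independent (fun (ij : 'I_m * 'I_p) w => M w ij.1 ij.2).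

Definition random_tensor m p N (Om : T -> tensor R m p N.+1) : Prop :=
  standard_gaussian_mx (fun w => Om w 0) /\
  forall w l, l != 0 -> Om w l = 0.

End RandomTensor.

(* Main.v *)
Require Import Defs.
From mathcomp Require Import all_boot all_order all_algebra.
From mathcomp Require Import complex.
From mathcomp Require Import all_classical all_reals all_analysis.
From mathcomp Require Import ring lra.

Import Order.TTheory GRing.Theory Num.Theory.
Local Open Scope ring_scope.

(** The discrete Fourier transform [dft] turns the T-product into the product
    of matrices over the complex numbers in every frequency, the transpose into
    the conjugate transpose ([dft_mul], [dft_tr]), and it is injective
    ([dft_inj]). Hence tensors satisfy all the identities of matrices with an
    adjoint: the T-product is associative, transposition reverses it, and a
    one-sided inverse of a square tensor is two-sided ([tmul1C]). Everything
    else is a computation with Y = U * S * V^T, where U^T * U = I,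
    V^T * V = V * V^T = I, and S^T = S because the singular values of the
    Fourier slices are real.

    Since Y^T * Y = V * S * S * V^T, this Gram tensor is invertible exactly when
    S is, with inverse V * S^-1 * S^-1 * V^T.  If S is invertible, then
    Q = Y * V * S^-1 = U and B = (X^T * Y * V * S^-1)^T = U^T * X, so that
    Q * B = U * U^T * X.  The basic algorithm returns Q0 * Q0^T * X, where
    Y = Q0 * T0.  Then U = Q0 * (T0 * V * S^-1), and two orthonormal factors
    that differ by a square factor define the same projector
    ([orthonormal_proj_unique]): the two approximations are equal, not only
    their errors.

    For the norm, ||B||^2 is the trace of the first slice of B * B^T
    ([fnormE]), which is S^-1 * V^T * W^T * W * V * S^-1; that trace is cyclic
    ([ttrace_mulC]), and moving S^-1 * V^T to the end produces
    W^T * W * (Y^T * Y)^-1. *)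

(** * The discrete Fourier transform is a faithful *-representation *)

Section FourierTransform.
Set Implicit Arguments.
Unset Strict Implicit.
Context {R : realType} {N : nat}.
Local Notation z := (@dft_root R N).

Lemma dft_root_exp (n : nat) :
  z ^+ n = Complex (cos (n%:R * (2 * pi / N.+1%:R)))
                   (- sin (n%:R * (2 * pi / N.+1%:R))).
Proof.
elim: n => [|n IHn]; first by rewrite expr0 mul0r cos0 sin0 oppr0.
rewrite exprS IHn /dft_root; set t := _ / _.
have -> : n.+1%:R * t = t + n%:R * t by rewrite -natr1; ring.
rewrite cosD sinD.
by apply/eqP; rewrite eq_complex /=; apply/andP; split; apply/eqP; ring.
Qed.

(** If the order of the root were m <= N, then cos (2 y) = 1 for
    y = m pi / (N + 1), so sin y = 0, which is impossible for 0 < y < pi. *)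
Lemma dft_root_prim : N.+1.-primitive_root z.
Proof.
have n_neq0 : N.+1%:R != 0 :> R by rewrite pnatr_eq0.
have zN : z ^+ N.+1 = 1.
  rewrite dft_root_exp mulrCA divff // mulr1 mulr_natl cos2pi sin2pi oppr0.
  by [].
have [m z_prim /dvdn_leq m_le] := prim_order_exists (ltn0Sn N) zN.
suff <- : m = N.+1 by [].
apply/eqP; rewrite eqn_leq m_le //=; case: leqP => // m_lt.
have m_gt0 := prim_order_gt0 z_prim.
set y : R := m%:R * (pi / N.+1%:R).
have y_range : 0 < y < pi.
  rewrite /y mulrA ltr_pdivlMr ?ltr0n // mul0r mulr_gt0 ?ltr0n ?pi_gt0 //=.
  by rewrite ltr_pdivrMr ?ltr0n // mulrC ltr_pM2l ?pi_gt0 // ltr_nat.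
have := prim_expr_order z_prim; rewrite dft_root_exp => -[+ _].
have -> : m%:R * (2 * pi / N.+1%:R) = y *+ 2 :> R by rewrite /y; ring.
rewrite cos_mulr2n cos2sin2 => cos1.
have := sin_gt0_pi y_range; rewrite lt0r => /andP[/negP[]].
by rewrite -sqrf_eq0; apply/eqP; lra.
Qed.

(** The index a + b is reduced modulo N + 1, which a root of unity does not
    notice. *)
Lemma unity_root_expD (u : R[i]) (a b : 'I_N.+1) :
  u ^+ N.+1 = 1 -> u ^+ (a + b)%R = u ^+ a * u ^+ b.
Proof. by move=> u1; rewrite /= expr_mod // exprD. Qed.

Lemma dft_root_pow_unity (q : nat) : (z ^+ q) ^+ N.+1 = 1.
Proof. by rewrite exprAC (prim_expr_order dft_root_prim) expr1n. Qed.

Lemma dft_root_unit : z^*%C * z = 1.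
Proof.
rewrite /dft_root; set t := _ / _.
apply/eqP; rewrite eq_complex /= opprK; apply/andP; split; apply/eqP.
  by rewrite -(cos2Dsin2 t); ring.
by ring.
Qed.

Lemma dftE m p (X : tensor R m p N.+1) q i j :
  dft X q i j = \sum_(l < N.+1) z ^+ q ^+ l * (X l i j)%:C%C.
Proof.
rewrite /dft summxE; apply: eq_bigr => l _.
by rewrite !mxE mulnC exprM.
Qed.

(** For fixed i and j, the entries (i, j) of the slices of X - Y are the
    coefficients of a polynomial of degree at most N, whose values at the N + 1
    distinct roots of unity are the entries of the difference of the
    transforms. *)
Lemma dft_inj m p (X Y : tensor R m p N.+1) : dft X =1 dft Y -> X = Y.
Proof.
move=> eqXY; apply/ffunP => l; apply/matrixP => i j.
pose c (n : nat) : R[i] := (X (inord n) i j)%:C%C - (Y (inord n) i j)%:C%C.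
pose rs := [seq z ^+ (q : 'I_N.+1) | q <- enum 'I_N.+1].
have poly0 : \poly_(n < N.+1) c n = 0.
  apply: (@roots_geq_poly_eq0 _ _ rs).
  - apply/allP => _ /mapP[q _ ->]; apply/rootP.
    rewrite horner_poly; apply/eqP.
    have /eqP := congr1 (fun A : 'M[R[i]]_(m, p) => A i j) (eqXY q).
    rewrite /= !dftE -subr_eq0 -sumrB; congr (_ == _).
    by apply: eq_bigr => n _; rewrite /c inord_val mulrBl !(mulrC (z ^+ q ^+ n)).
  - rewrite map_inj_uniq ?enum_uniq // => q q' /eqP.
    rewrite (eq_prim_root_expr dft_root_prim) !modn_small ?ltn_ord //.
    by move=> /eqP/val_inj.
  by rewrite size_map size_enum_ord size_poly.
apply: complexI; apply/eqP; rewrite -subr_eq0.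
have := congr1 (fun p : {poly R[i]} => p`_l) poly0.
by rewrite coef_poly ltn_ord coef0 /c inord_val => ->.
Qed.

Lemma tmulE m p r (X : tensor R m p N.+1) (Y : tensor R p r N.+1) l :
  (X *t Y) l = \sum_h X h *m Y (l - h).
Proof.
apply/matrixP => i j; rewrite ffunE mxE sum_ffunE summxE.
under eq_bigr => h _ do rewrite ffunE.
rewrite exchange_big; apply: eq_bigr => h _.
by rewrite mxE; apply: eq_bigr => g _; rewrite !ffunE.
Qed.

Lemma dft_mul m p r (X : tensor R m p N.+1) (Y : tensor R p r N.+1) q :
  dft (X *t Y) q = dft X q *m dft Y q.
Proof.
rewrite /dft mulmx_suml.
under eq_bigr => l _ do rewrite tmulE raddf_sum scaler_sumr.
rewrite exchange_big; apply: eq_bigr => h _ /=.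
rewrite mulmx_sumr (reindex_inj (addrI h)); apply: eq_bigr => l _.
rewrite [h + l]addrC addrK map_mxM -scalemxAl -scalemxAr scalerA.
rewrite addrC !(mulnC _ q) !exprM.
by rewrite unity_root_expD ?dft_root_pow_unity.
Qed.

Lemma dft_tr m p (X : tensor R m p N.+1) q : dft (ttr X) q = adjmx (dft X q).
Proof.
apply/matrixP => i j; rewrite !mxE !dftE (reindex_inj oppr_inj) rmorph_sum.
apply: eq_bigr => l _; rewrite ffunE opprK mxE.
transitivity ((z^*%C ^+ q ^+ l) * (X l j i)%:C%C); last first.
  by rewrite -[in LHS]conjc_real -!rmorphXn -rmorphM.
congr (_ * _).
(* |z| = 1, so that conjugating z inverts it, as negating the index does *)
have zq1 : (z^*%C ^+ q ^+ l) * (z ^+ q ^+ l) = 1.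
  by rewrite -!exprMn dft_root_unit !expr1n.
rewrite -[LHS]mul1r -[in LHS]zq1 -mulrA.
by rewrite -unity_root_expD ?dft_root_pow_unity // subrr expr0 mulr1.
Qed.

Lemma dft_id m q : dft (tid m : tensor R m m N.+1) q = 1%:M.
Proof.
rewrite /dft (bigD1 ord0) //= big1 => [|l l_neq0].
  by rewrite mul0n expr0 scale1r addr0 ffunE eqxx map_mx1.
by rewrite ffunE (negbTE l_neq0) map_mx0 scaler0.
Qed.

End FourierTransform.

(** * The *-algebra of tensors under the T-product *)

Section TAlgebra.
Set Implicit Arguments.
Unset Strict Implicit.
Context {R : realType} {N : nat}.
Local Notation tens m p := (tensor R m p N.+1).

Lemma tmulA m p r s (A : tens m p) (B : tens p r) (C : tens r s) :
  A *t (B *t C) = A *t B *t C.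
Proof. by apply: dft_inj => q; rewrite !dft_mul mulmxA. Qed.

Lemma tmul1t m p (A : tens m p) : tid m *t A = A.
Proof. by apply: dft_inj => q; rewrite dft_mul dft_id mul1mx. Qed.

Lemma tmult1 m p (A : tens m p) : A *t tid p = A.
Proof. by apply: dft_inj => q; rewrite dft_mul dft_id mulmx1. Qed.

Lemma ttrK m p (A : tens m p) : ttr (ttr A) = A.
Proof. by apply/ffunP => l; rewrite !ffunE opprK trmxK. Qed.

Lemma ttr_mul m p r (A : tens m p) (B : tens p r) :
  ttr (A *t B) = ttr B *t ttr A.
Proof.
apply: dft_inj => q; rewrite dft_tr !dft_mul !dft_tr.
by rewrite /adjmx map_mxM trmx_mul.
Qed.

Lemma ttr_id m : ttr (tid m) = tid m :> tens m m.
Proof.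
by apply/ffunP => l; rewrite !ffunE oppr_eq0; case: eqP; rewrite ?trmx1 ?trmx0.
Qed.

(** Holds because it holds for square complex matrices in each frequency. *)
Lemma tmul1C m (A B : tens m m) : A *t B = tid m -> B *t A = tid m.
Proof.
move=> AB1; apply: dft_inj => q; rewrite dft_mul dft_id; apply: mulmx1C.
by rewrite -dft_mul AB1 dft_id.
Qed.

Lemma tinvP m (A : tens m m) : tinvertible A -> is_tinv A (tinv A).
Proof. exact: (xgetPex 0). Qed.

Lemma tinv_unique m (A B : tens m m) : A *t B = tid m -> tinv A = B.
Proof.
move=> AB1; have BA1 := tmul1C AB1.
apply: xget_unique => [|C [_ CA1]]; first by split.
by rewrite -[C]tmult1 -AB1 tmulA CA1 tmul1t.
Qed.

(** Slice 0 of A * A^T is the sum of the A_l * A_l^T, because slice -l of A^T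
    is the transpose of A_l. *)
Lemma fnormE m p (A : tens m p) : fnorm A ^+ 2 = \tr ((A *t ttr A) 0).
Proof.
rewrite sqr_sqrtr; last by do 3!apply: sumr_ge0 => ? _; apply: sqr_ge0.
rewrite tmulE raddf_sum; apply: eq_bigr => l _; apply: eq_bigr => i _.
rewrite mxE; apply: eq_bigr => j _.
by rewrite ffunE sub0r opprK mxE expr2.
Qed.

(** Slice 0 of A * B pairs A_l with B_(-l); the bijection l |-> - l reduces this
    to the cyclicity of the matrix trace. *)
Lemma ttrace_mulC m p (A : tens m p) (B : tens p m) :
  \tr ((A *t B) 0) = \tr ((B *t A) 0).
Proof.
rewrite !tmulE !raddf_sum (reindex_inj oppr_inj); apply: eq_bigr => l _ /=.
by rewrite !sub0r opprK mxtrace_mulC.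
Qed.

(** * Orthonormal factors, Gram tensor and singular values *)

(** Orthonormality of both factors forces Z^T * Z = I, hence Z * Z^T = I as Z is
    square, and Z cancels in U * U^T. This is why the approximation does not
    depend on the choice of the orthonormal basis. *)
Lemma orthonormal_proj_unique m k (U Q : tens m k) (Z : tens k k) :
  ttr U *t U = tid k -> ttr Q *t Q = tid k -> U = Q *t Z ->
  U *t ttr U = Q *t ttr Q.
Proof.
move=> UU QQ defU.
have ZZ : Z *t ttr Z = tid k.
  apply: tmul1C; rewrite -UU defU ttr_mul -tmulA (tmulA (ttr Q)) QQ tmul1t.
  by [].
by rewrite defU ttr_mul -tmulA (tmulA Z) ZZ tmul1t.
Qed.

(** The symmetry of S is where the realness of the singular values enters: each
    Fourier slice of S is a nonnegative diagonal matrix, which equals its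
    conjugate transpose. *)
Lemma econ_tsvd_factors m k (Y U : tens m k) (S V : tens k k) :
  is_econ_tsvd Y U S V ->
  [/\ Y = U *t S *t ttr V, ttr U *t U = tid k, ttr V *t V = tid k
    & ttr S = S].
Proof.
move=> svd; split; apply: dft_inj => q; have [Yq Uq Vq [d [Sq d_ge0 _]]] := svd q.
- by rewrite !dft_mul dft_tr.
- by rewrite dft_mul dft_tr dft_id.
- by rewrite dft_mul dft_tr dft_id.
rewrite dft_tr Sq /adjmx map_diag_mx tr_diag_mx; congr diag_mx.
by apply/rowP => j; rewrite mxE; apply: geC0_conj.
Qed.

Lemma thin_tqr_factors m k (Y Q : tens m k) (T : tens k k) :
  is_thin_tqr Y Q T -> Y = Q *t T /\ ttr Q *t Q = tid k.
Proof.
move=> qr; split; apply: dft_inj => q; have [Yq Qq _] := qr q.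
  by rewrite dft_mul.
by rewrite dft_mul dft_tr dft_id.
Qed.

Lemma gram_tsvd m k (Y U : tens m k) (S V : tens k k) :
  is_econ_tsvd Y U S V -> ttr Y *t Y = V *t S *t S *t ttr V.
Proof.
case/econ_tsvd_factors=> -> UU _ SS.
by rewrite !ttr_mul ttrK SS !tmulA -(tmulA _ (ttr U) U) UU tmult1.
Qed.

Lemma gram_tinv m k (Y U : tens m k) (S V S' : tens k k) :
  is_econ_tsvd Y U S V -> S *t S' = tid k ->
  (ttr Y *t Y) *t (V *t S' *t S' *t ttr V) = tid k.
Proof.
move=> svd SS'; have [_ _ /[dup] VV /tmul1C VV' _] := econ_tsvd_factors svd.
rewrite (gram_tsvd svd) !tmulA -(tmulA _ (ttr V) V) VV tmult1.
by rewrite -(tmulA _ S S') SS' tmult1 -(tmulA _ S S') SS' tmult1.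
Qed.

(** If M inverts Y^T * Y = V * S * S * V^T, then conjugating by V gives
    S * (S * V^T * M * V) = I. *)
Lemma tsvd_invertible_gram m k (Y U : tens m k) (S V : tens k k) :
  is_econ_tsvd Y U S V -> tinvertible S <-> tinvertible (ttr Y *t Y).
Proof.
move=> svd; split=> [[S' [SS' _]]|[M [GM _]]].
  have GM := gram_tinv svd SS'.
  by exists (V *t S' *t S' *t ttr V); split=> //; apply: tmul1C.
have [_ _ VV _] := econ_tsvd_factors svd.
pose S' := S *t ttr V *t M *t V.
have SS' : S *t S' = tid k.
  rewrite /S' -[S in S *t _]tmul1t -VV.
  have := congr1 (fun A => ttr V *t A *t V) GM.
  by rewrite (gram_tsvd svd) tmult1 !tmulA.
by exists S'; split=> //; apply: tmul1C.
Qed.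

End TAlgebra.

Theorem theorem5 (R : realType) (d : measure_display) (T : measurableType d)
    (P : probability T R) (I1 I2 k N : nat) (k_le_I1 : (k <= I1)%N)
    (X : tensor R I1 I2 N.+1) (Omega : T -> tensor R I2 k N.+1)
    (Omega_random : random_tensor P Omega)
    (w : T) (U : tensor R I1 k N.+1) (S V : tensor R k k N.+1) :
  let Y := X *t Omega w in
  let W := ttr X *t Y in
  is_econ_tsvd Y U S V ->
  (tinvertible S <-> tinvertible (ttr Y *t Y)) /\
  (tinvertible S ->
    let Q := Y *t V *t tinv S in
    let B := ttr (W *t V *t tinv S) in
    let G := ttr W *t W *t tinv (ttr Y *t Y) in
    (forall A : tensor R I1 I2 N.+1, is_basic_rtsvd X (Omega w) A ->
       fnorm (X - Q *t B) = fnorm (X - A)) /\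
    fnorm B ^+ 2 = \tr (G 0)).
Proof.
move=> Y W svd.
have YE : X *t Omega w = Y by [].
have WE : W = ttr X *t Y by [].
(* with the bodies of Y and W opaque, rewriting cannot look inside them *)
clearbody W; clearbody Y; split; first exact: tsvd_invertible_gram svd.
move=> /tinvP[SS' _] Q B G.
have [defY UU VV SS] := econ_tsvd_factors svd.
have defQ : Q = U.
  rewrite /Q [Y]defY -(tmulA _ (ttr V) V) VV tmult1 -tmulA SS' tmult1.
  by [].
have defB : B = ttr U *t X.
  by rewrite /B WE -!tmulA (tmulA Y) -/Q defQ ttr_mul ttrK.
split=> [A [Q0 [T0 []]]|].
  rewrite YE => /thin_tqr_factors[defY0 QQ0] ->.
  have defU : U = Q0 *t (T0 *t V *t tinv S).
    by rewrite -defQ /Q [Y]defY0 !tmulA.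
  rewrite defQ defB !tmulA.
  by rewrite (orthonormal_proj_unique UU QQ0 defU).
have S'S : ttr (tinv S) = tinv S.
  apply/esym/tinv_unique; apply: tmul1C.
  by rewrite -[S in _ *t S]SS -ttr_mul SS' ttr_id.
have BE : B = tinv S *t ttr V *t ttr W by rewrite /B !ttr_mul S'S tmulA.
rewrite fnormE {1}BE /B ttrK /G (tinv_unique (gram_tinv svd SS')).
(* a cyclic shift moves S^-1 * V^T from the front of B * B^T to its end *)
by rewrite -(tmulA _ (ttr W)) ttrace_mulC !tmulA.
Qed.
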